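(* Let $0<r<1$ and let $(T_1,\dots,T_d)$ be a doubly commuting tuple of operators in $C_{1,r}$ acting on a Hilbert space $\mathcal H$. If $\sigma((T_j^*T_j)^{1/2})$ is a finite subset of $(r,1)$ for $1\le j\le d$, then there exist a Hilbert space $\mathcal K$, an isometry $V:\mathcal H\to\mathcal K$ and a doubly commuting tuple $(M_1,\dots,M_d)$ of operators in $\mathcal C_{1,r}$ acting on $\mathcal K$ such that $T_1^{n_1}\cdots T_d^{n_d}=V^*M_1^{n_1}\cdots M_d^{n_d}V$ for all integers $n_1,\dots,n_d$.
   Context: $C_{1,r}=\{T: T\text{ invertible},\ \|T\|\le1,\ \|rT^{-1}\|\le1\}$. $\mathcal C_{1,r}$ is the class of operators $M$ on a Hilbert space $\mathcal K$ for which there exist orthogonal projections $P_0,P_1$ on $\mathcal K$ with $P_0+P_1=I_{\mathcal K}$ and $M^*M=P_0+r^2P_1$. A tuple is doubly commuting if $T_iT_j=T_jT_i$ for all $i,j$ and $T_iT_j^*=T_j^*T_i$ for $i\ne j$. Negative powers $M_j^{n}$, $n<0$, refer to inverses (the $M_j$ being invertible). *)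

(* Defs.v *)
From HB Require Import structures.
From mathcomp Require Import all_boot all_order all_algebra.
From mathcomp Require Import complex.
From mathcomp Require Import reals.
Set Implicit Arguments. Unset Strict Implicit. Unset Printing Implicit Defensive.
Import Order.TTheory GRing.Theory Num.Theory.
Local Open Scope ring_scope.
Local Open Scope complex_scope.

Record Hilbert (R : rcfType) := {
  hcar :> lmodType R[i];
  inner : hcar -> hcar -> R[i];
  inner_linl : forall (a : R[i]) (x y z : hcar),
      inner (a *: x + y) z = a * inner x z + inner y z;
  inner_conj : forall x y : hcar, inner y x = (inner x y)^*;
  inner_ge0 : forall x : hcar, 0 <= inner x x;
  inner_eq0 : forall x : hcar, inner x x = 0 -> x = 0;
  hcomplete : forall u : nat -> hcar,
      (forall e : R[i], 0 < e -> exists N : nat, forall m n : nat,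
          (N <= m)%N -> (N <= n)%N -> inner (u m - u n) (u m - u n) < e) ->
      exists l : hcar, forall e : R[i], 0 < e -> exists N : nat,
          forall n : nat, (N <= n)%N -> inner (u n - l) (u n - l) < e
}.
Arguments inner {R} h _ _.

Section Ops.
Variable R : rcfType.

Definition nsq (H : Hilbert R) (x : H) : R[i] := inner H x x.

Definition is_lin (H K : Hilbert R) (f : H -> K) :=
  forall (a : R[i]) (x y : H), f (a *: x + y) = a *: f x + f y.

Definition is_bounded (H K : Hilbert R) (f : H -> K) :=
  exists C : R[i], forall x : H, nsq (f x) <= C * nsq x.

Definition is_bop (H K : Hilbert R) (f : H -> K) := is_lin f /\ is_bounded f.

Definition is_adjoint (H K : Hilbert R) (T : H -> K) (S : K -> H) :=
  forall (x : H) (y : K), inner K (T x) y = inner H x (S y).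

Definition is_inverse (H K : Hilbert R) (T : H -> K) (Ti : K -> H) :=
  is_bop Ti /\ (forall x, Ti (T x) = x) /\ (forall y, T (Ti y) = y).

Definition is_isometry (H K : Hilbert R) (V : H -> K) :=
  is_lin V /\ forall x y : H, inner K (V x) (V y) = inner H x y.

Definition is_orth_proj (H : Hilbert R) (P : H -> H) :=
  is_bop P /\ (forall x, P (P x) = P x) /\ is_adjoint P P.

Definition is_positive (H : Hilbert R) (A : H -> H) :=
  is_bop A /\ is_adjoint A A /\ forall x, 0 <= inner H (A x) x.

Definition spectrum (H : Hilbert R) (A : H -> H) (l : R[i]) : Prop :=
  ~ exists B : H -> H, is_inverse (fun x => A x - l *: x) B.

Definition in_C1r (r : R) (H : Hilbert R) (T Ti : H -> H) :=
  is_bop T /\ is_inverse T Ti /\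
  (forall x, nsq (T x) <= nsq x) /\
  (forall x, nsq (r%:C *: Ti x) <= nsq x).

(* M in the class \mathcal C_{1,r}, Ma being the adjoint of M *)
Definition in_calC1r (r : R) (H : Hilbert R) (M Ma : H -> H) :=
  is_bop M /\ exists P0 P1 : H -> H,
    is_orth_proj P0 /\ is_orth_proj P1 /\ (forall x, P0 x + P1 x = x) /\
    (forall x, Ma (M x) = P0 x + (r ^+ 2)%:C *: P1 x).

(* doubly commuting tuple, Ta j being the adjoint of T j *)
Definition doubly_commuting (d : nat) (H : Hilbert R) (T Ta : 'I_d -> H -> H) :=
  (forall i j x, T i (T j x) = T j (T i x)) /\
  (forall i j x, i != j -> T i (Ta j x) = Ta j (T i x)).

Definition zpow (H : Hilbert R) (T Ti : H -> H) (n : int) : H -> H :=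
  match n with
  | Posz k => iter k T
  | Negz k => iter k.+1 Ti
  end.

Definition multipow (d : nat) (H : Hilbert R) (T Ti : 'I_d -> H -> H)
  (n : 'I_d -> int) : H -> H :=
  foldr (fun i acc => zpow (T i) (Ti i) (n i) \o acc) id (enum 'I_d).

End Ops.

(* Main.v *)
(* Let B = T^*T, so that r^2 <= B <= 1, and choose commuting self-adjoint C, S with
   C^2 = (B - r^2)/(1 - r^2) and S^2 = (1 - B)/(1 - r^2).  Then V x = (C x, S x) is an
   isometry H -> H + H and, with D = diag(1, r), the map D V x |-> V T x is isometric,
   because C^2 + r^2 S^2 = B.  Its extension W to a unitary of H + H can be written
   with C, S, B^-1 and T only, so M = W D satisfies M V = V T, M^*M = diag(1, r^2), and
   commutes with E + E whenever E commutes with T and T^*.  Applying this to one T_j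
   at a time, and replacing the other T_i by T_i + T_i, gives the tuple on the sum of
   2^d copies of H; M_j V = V T_j yields the identity for all integer powers. *)
Require Import Defs.
From HB Require Import structures.
From mathcomp Require Import all_boot all_order all_algebra.
From mathcomp Require Import complex.
From mathcomp Require Import boolp classical_sets reals.
From mathcomp Require Import ring lra.
Import Order.TTheory GRing.Theory Num.Theory.
Local Open Scope ring_scope.
Local Open Scope complex_scope.

Set Implicit Arguments. Unset Strict Implicit. Unset Printing Implicit Defensive.

(** * Real inner product and squared norm *)

Section InnerProduct.
Variables (R : rcfType) (H : Hilbert R).
Implicit Types x y z : H.

(** Real parts carry every norm estimate into the ordered field [R], where [lra] applies; [nsqE]
    translates back, since a nonnegative element of [R[i]] has zero imaginary part. *)
Definition rinner x y : R := complex.Re (inner H x y).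
Definition rnorm2 x : R := rinner x x.

Lemma rinnerC x y : rinner x y = rinner y x.
Proof. by rewrite /rinner (inner_conj x y); case: (inner H x y). Qed.

Lemma inner0l y : inner H 0 y = 0.
Proof.
have := inner_linl 1 0 0 y; rewrite scale1r addr0 mul1r => /eqP.
by rewrite -subr_eq0 opprD addrA subrr sub0r oppr_eq0 => /eqP.
Qed.

Lemma innerDl x y z : inner H (x + y) z = inner H x z + inner H y z.
Proof. by rewrite -[x]scale1r inner_linl mul1r scale1r. Qed.

Lemma innerZl a x z : inner H (a *: x) z = a * inner H x z.
Proof. by rewrite -[a *: x]addr0 inner_linl inner0l addr0. Qed.

Lemma innerNl x z : inner H (- x) z = - inner H x z.
Proof. by rewrite -scaleN1r innerZl mulN1r. Qed.

Lemma inner0r x : inner H x 0 = 0.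
Proof. by rewrite inner_conj inner0l rmorph0. Qed.

Lemma innerDr x y z : inner H x (y + z) = inner H x y + inner H x z.
Proof. by rewrite inner_conj innerDl rmorphD /= -!inner_conj. Qed.

Lemma innerZr a x z : inner H x (a *: z) = conjc a * inner H x z.
Proof. by rewrite inner_conj innerZl rmorphM /= -!inner_conj. Qed.

Lemma innerNr x z : inner H x (- z) = - inner H x z.
Proof. by rewrite inner_conj innerNl rmorphN /= -!inner_conj. Qed.

Lemma inner_inj x y : (forall z, inner H x z = inner H y z) -> x = y.
Proof.
move=> e; apply/eqP; rewrite -subr_eq0; apply/eqP/inner_eq0.
by rewrite innerDl innerNl e subrr.
Qed.

Lemma rinnerDl x y z : rinner (x + y) z = rinner x z + rinner y z.
Proof. by rewrite /rinner innerDl raddfD. Qed.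

Lemma rinnerNl x z : rinner (- x) z = - rinner x z.
Proof. by rewrite /rinner innerNl raddfN. Qed.

Lemma rinnerZl (a : R) x z : rinner (a%:C *: x) z = a * rinner x z.
Proof. by rewrite /rinner innerZl; case: inner => u v /=; ring. Qed.

Lemma rinnerDr x y z : rinner x (y + z) = rinner x y + rinner x z.
Proof. by rewrite rinnerC rinnerDl !(rinnerC x). Qed.

Lemma rinnerNr x z : rinner x (- z) = - rinner x z.
Proof. by rewrite rinnerC rinnerNl rinnerC. Qed.

Lemma rinnerZr (a : R) x z : rinner x (a%:C *: z) = a * rinner x z.
Proof. by rewrite rinnerC rinnerZl rinnerC. Qed.

Lemma nsqE x : nsq x = (rnorm2 x)%:C.
Proof.
by have := ger0_Im (inner_ge0 x); rewrite /nsq /rnorm2 /rinner; case: inner => u v /= ->.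
Qed.

Lemma rnorm2_ge0 x : 0 <= rnorm2 x.
Proof. by rewrite -ler0c -nsqE inner_ge0. Qed.

Lemma rnorm2_0 : rnorm2 0 = 0.
Proof. by rewrite /rnorm2 /rinner inner0l. Qed.

Lemma rnorm2_eq0 x : rnorm2 x = 0 -> x = 0.
Proof. by move=> e; apply: inner_eq0; rewrite [LHS]nsqE e. Qed.

Lemma rnorm2Z (a : R) x : rnorm2 (a%:C *: x) = a ^+ 2 * rnorm2 x.
Proof. by rewrite /rnorm2 rinnerZl rinnerZr expr2 mulrA. Qed.

Lemma rnorm2Zc (a : R[i]) x :
  rnorm2 (a *: x) = (complex.Re a ^+ 2 + complex.Im a ^+ 2) * rnorm2 x.
Proof.
rewrite /rnorm2 /rinner innerZl innerZr [inner H x x]nsqE.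
by case: a => u v /=; ring.
Qed.

Lemma rnorm2N x : rnorm2 (- x) = rnorm2 x.
Proof. by rewrite /rnorm2 rinnerNl rinnerNr opprK. Qed.

Lemma rnorm2D x y : rnorm2 (x + y) = rnorm2 x + rnorm2 y + 2 * rinner x y.
Proof. by rewrite /rnorm2 !rinnerDl !rinnerDr (rinnerC y x); ring. Qed.

Lemma rnorm2B x y : rnorm2 (x - y) = rnorm2 x + rnorm2 y - 2 * rinner x y.
Proof. by rewrite rnorm2D rnorm2N rinnerNr; ring. Qed.

Lemma rnorm2D_le x y : rnorm2 (x + y) <= 2 * rnorm2 x + 2 * rnorm2 y.
Proof. by have := rnorm2_ge0 (x - y); rewrite rnorm2B rnorm2D; lra. Qed.

Lemma rnorm2BB_le x y z :
  rnorm2 (x - z) <= 2 * rnorm2 (x - y) + 2 * rnorm2 (y - z).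
Proof. by have := rnorm2D_le (x - y) (y - z); rewrite addrA subrK. Qed.

Lemma rnorm2BC x y : rnorm2 (x - y) = rnorm2 (y - x).
Proof. by rewrite -rnorm2N opprB. Qed.

(** Expanding the squared norm of t x - y and dividing by t. This weighted inequality serves instead
    of Cauchy-Schwarz, so that no square root of a norm appears. *)
Lemma rinner_le (t : R) x y : 0 < t ->
  2 * rinner x y <= t * rnorm2 x + t^-1 * rnorm2 y.
Proof.
move=> t0; have := rnorm2_ge0 (t%:C *: x - y).
rewrite rnorm2B rnorm2Z rinnerZl => h.
have ti : 0 < t^-1 by rewrite invr_gt0.
have /(mulr_ge0 (ltW ti)) := h.
have -> : t^-1 * (t ^+ 2 * rnorm2 x + rnorm2 y - 2 * (t * rinner x y)) =
  t * rnorm2 x + t^-1 * rnorm2 y - 2 * rinner x y by field; rewrite gt_eqF.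
by lra.
Qed.

(** The sharp triangle inequality in squared form. The weight t = d / c in [rinner_le] makes both
    terms of the bound on the cross term equal to c d n; the cases c = 0 and d = 0, where t or its
    inverse degenerates, force x = 0 or y = 0. *)
Lemma rnorm2_Dle (c d : R) x y (n : R) : 0 <= c -> 0 <= d ->
  rnorm2 x <= c ^+ 2 * n -> rnorm2 y <= d ^+ 2 * n ->
  rnorm2 (x + y) <= (c + d) ^+ 2 * n.
Proof.
move=> c0 d0 hx hy.
have [c00|c1] := eqVneq c 0.
  have : rnorm2 x = 0.
    by apply/le_anti; rewrite rnorm2_ge0 andbT (le_trans hx)// c00; lra.
  by move=> /rnorm2_eq0 ->; rewrite c00 !add0r.
have [d00|d1] := eqVneq d 0.
  have : rnorm2 y = 0.
    by apply/le_anti; rewrite rnorm2_ge0 andbT (le_trans hy)// d00; lra.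
  by move=> /rnorm2_eq0 ->; rewrite d00 !addr0.
have cp : 0 < c by rewrite lt_def c1.
have dp : 0 < d by rewrite lt_def d1.
have t0 : 0 < d / c by rewrite divr_gt0.
have := rinner_le x y t0; rewrite rnorm2D invf_div.
have h1 : d / c * rnorm2 x <= d / c * (c ^+ 2 * n) by rewrite ler_wpM2l// ltW.
have h2 : c / d * rnorm2 y <= c / d * (d ^+ 2 * n).
  by rewrite ler_wpM2l// ltW// divr_gt0.
have e1 : d / c * (c ^+ 2 * n) = c * d * n by field.
have e2 : c / d * (d ^+ 2 * n) = c * d * n by field.
rewrite e1 in h1; rewrite e2 in h2 => h3.
have -> : (c + d) ^+ 2 * n = c ^+ 2 * n + d ^+ 2 * n + 2 * (c * d * n) by ring.
lra.
Qed.

End InnerProduct.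

(** * Adjoints, bounded operators and commutation *)

Section Operators.
Variables (R : rcfType).
Implicit Types H K L : Hilbert R.

Lemma is_linD H K (f : H -> K) : is_lin f -> {morph f : x y / x + y}.
Proof. by move=> fl x y; have := fl 1 x y; rewrite !scale1r. Qed.

Lemma is_lin0 H K (f : H -> K) : is_lin f -> f 0 = 0.
Proof. by move=> fl; apply: (addrI (f 0)); rewrite -is_linD// !addr0. Qed.

Lemma is_linZ H K (f : H -> K) : is_lin f -> forall a x, f (a *: x) = a *: f x.
Proof. by move=> fl a x; have := fl a x 0; rewrite !addr0 is_lin0// addr0. Qed.

Lemma is_linN H K (f : H -> K) : is_lin f -> {morph f : x / - x}.
Proof. by move=> fl x; rewrite -scaleN1r is_linZ// scaleN1r. Qed.

Lemma is_linB H K (f : H -> K) : is_lin f -> {morph f : x y / x - y}.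
Proof. by move=> fl x y; rewrite is_linD// is_linN. Qed.

(** The inner product separates points. Most operators built later get their linearity from an
    explicit adjoint in this way. *)
Lemma adjoint_lin H K (f : H -> K) g : is_adjoint f g -> is_lin f.
Proof.
move=> fg a x y; apply: inner_inj => z.
by rewrite inner_linl !fg inner_linl.
Qed.

Lemma adjoint_sym H K (f : H -> K) g : is_adjoint f g -> is_adjoint g f.
Proof. by move=> fg y x; rewrite inner_conj -fg -inner_conj. Qed.

Lemma rinner_adj H K (f : H -> K) g : is_adjoint f g ->
  forall x y, rinner (f x) y = rinner x (g y).
Proof. by move=> fg x y; rewrite /rinner fg. Qed.

Lemma adjoint_id H : is_adjoint (@id H) id. Proof. by []. Qed.

Lemma adjoint_comp H K L (f : H -> K) f' (g : K -> L) g' :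
  is_adjoint f f' -> is_adjoint g g' ->
  is_adjoint (fun x => g (f x)) (fun y => f' (g' y)).
Proof. by move=> ff gg x y; rewrite gg ff. Qed.

Lemma adjointD H K (f g : H -> K) f' g' : is_adjoint f f' -> is_adjoint g g' ->
  is_adjoint (fun x => f x + g x) (fun y => f' y + g' y).
Proof. by move=> ff gg x y; rewrite innerDl innerDr ff gg. Qed.

Lemma adjointN H K (f : H -> K) f' : is_adjoint f f' ->
  is_adjoint (fun x => - f x) (fun y => - f' y).
Proof. by move=> ff x y; rewrite innerNl innerNr ff. Qed.

Lemma adjointB H K (f g : H -> K) f' g' : is_adjoint f f' -> is_adjoint g g' ->
  is_adjoint (fun x => f x - g x) (fun y => f' y - g' y).
Proof. by move=> ff gg; apply: adjointD => //; apply: adjointN. Qed.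

Lemma adjointZ H K (f : H -> K) f' (a : R) : is_adjoint f f' ->
  is_adjoint (fun x => a%:C *: f x) (fun y => a%:C *: f' y).
Proof. by move=> ff x y; rewrite innerZl innerZr conjc_real ff. Qed.

(** Squared norms are real, so only the real part of the complex constant in [is_bounded] matters;
    its absolute value is a nonnegative constant. *)
Lemma bounded_rnorm2 H K (f : H -> K) :
  is_bounded f <-> exists2 c : R, 0 <= c & forall x, rnorm2 (f x) <= c * rnorm2 x.
Proof.
split=> [[C h]|[c c0 h]]; last first.
  by exists c%:C => x; rewrite !nsqE -rmorphM lecR.
exists `|complex.Re C| => // x; have := h x; rewrite !nsqE lecE => /andP[_ /=].
case: C {h} => u v /=; rewrite mulr0 subr0 => /le_trans; apply.
by rewrite ler_wpM2r ?rnorm2_ge0// ler_norm.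
Qed.

Lemma bounded_id H : is_bounded (@id H).
Proof. by apply/bounded_rnorm2; exists 1 => // x; rewrite mul1r. Qed.

Lemma bounded_comp H K L (f : H -> K) (g : K -> L) :
  is_bounded f -> is_bounded g -> is_bounded (fun x => g (f x)).
Proof.
move=> /bounded_rnorm2[c c0 hf] /bounded_rnorm2[d d0 hg]; apply/bounded_rnorm2.
exists (d * c); first exact: mulr_ge0.
by move=> x; rewrite (le_trans (hg _))// -mulrA ler_wpM2l.
Qed.

Lemma boundedD H K (f g : H -> K) :
  is_bounded f -> is_bounded g -> is_bounded (fun x => f x + g x).
Proof.
move=> /bounded_rnorm2[c c0 hf] /bounded_rnorm2[d d0 hg]; apply/bounded_rnorm2.
exists (2 * c + 2 * d); first by rewrite addr_ge0// mulr_ge0.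
move=> x; rewrite (le_trans (rnorm2D_le _ _))//.
by have := hf x; have := hg x; lra.
Qed.

Lemma boundedN H K (f : H -> K) : is_bounded f -> is_bounded (fun x => - f x).
Proof.
move=> /bounded_rnorm2[c c0 hf]; apply/bounded_rnorm2.
by exists c => // x; rewrite rnorm2N.
Qed.

Lemma boundedB H K (f g : H -> K) :
  is_bounded f -> is_bounded g -> is_bounded (fun x => f x - g x).
Proof. by move=> bf bg; apply: boundedD => //; apply: boundedN. Qed.

Lemma boundedZ H K (f : H -> K) (a : R) :
  is_bounded f -> is_bounded (fun x => a%:C *: f x).
Proof.
move=> /bounded_rnorm2[c c0 hf]; apply/bounded_rnorm2.
exists (a ^+ 2 * c); first by rewrite mulr_ge0// sqr_ge0.
by move=> x; rewrite rnorm2Z -mulrA ler_wpM2l// sqr_ge0.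
Qed.

(** With weight 1, 2 |f' y|^2 = 2 Re <f (f' y), y> is at most |f (f' y)|^2 + |y|^2, hence at most
    |f' y|^2 + |y|^2. *)
Lemma contraction_adjoint_bounded H (f f' : H -> H) : is_adjoint f f' ->
  (forall x, rnorm2 (f x) <= rnorm2 x) -> is_bounded f'.
Proof.
move=> ff fc; apply/bounded_rnorm2; exists 1 => // y; rewrite mul1r.
have := rinner_le (f (f' y)) y ltr01; rewrite (rinner_adj ff) invr1 !mul1r.
by have := fc (f' y); rewrite /rnorm2; lra.
Qed.

Definition comm_op H (f g : H -> H) := forall x, f (g x) = g (f x).

Lemma comm_op_sym H (f g : H -> H) : comm_op f g -> comm_op g f.
Proof. by move=> fg x; rewrite fg. Qed.

Lemma comm_op_comp H (e f g : H -> H) :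
  comm_op e f -> comm_op e g -> comm_op e (fun x => f (g x)).
Proof. by move=> ef eg x; rewrite ef eg. Qed.

Lemma comm_op_adj H (f g f' g' : H -> H) :
  is_adjoint f f' -> is_adjoint g g' -> comm_op f g -> comm_op f' g'.
Proof.
move=> /adjoint_sym ff /adjoint_sym gg fg x; apply: inner_inj => z.
by rewrite ff gg gg ff fg.
Qed.

End Operators.

(** * Norm limits of sequences of vectors *)

Section Limits.
Variables (R : rcfType) (H : Hilbert R).
Implicit Types (u v : nat -> H) (l m : H).

Definition hlim u l := forall e : R, 0 < e ->
  exists N, forall n, (N <= n)%N -> rnorm2 (u n - l) < e.

Lemma hlim_unique u l m : hlim u l -> hlim u m -> l = m.
Proof.
move=> ul um; apply/eqP; rewrite -subr_eq0; apply/eqP/rnorm2_eq0/eqP.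
rewrite eq_le rnorm2_ge0 andbT; apply/ler_addgt0Pr => e e0; rewrite add0r.
have e4 : 0 < e / 4 by lra.
have [N hN] := ul _ e4; have [N' hN'] := um _ e4.
have := hN _ (leq_maxl N N'); have := hN' _ (leq_maxr N N').
rewrite [rnorm2 (_ - l)]rnorm2BC.
by have := rnorm2BB_le l (u (maxn N N')) m; lra.
Qed.

Lemma hlim_dominated v m (c : R) u l : 0 <= c ->
  (forall n, rnorm2 (u n - l) <= c * rnorm2 (v n - m)) -> hlim v m -> hlim u l.
Proof.
move=> c0 h vm e e0; have c1 : 0 < c + 1 by lra.
have [N hN] := vm _ (divr_gt0 e0 c1); exists N => n /hN.
rewrite ltr_pdivlMr// => hn; apply: le_lt_trans (h n) (le_lt_trans _ hn).
by have := rnorm2_ge0 (v n - m); lra.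
Qed.

Lemma hlimD u v l m : hlim u l -> hlim v m -> hlim (fun n => u n + v n) (l + m).
Proof.
move=> ul vm e e0; have e4 : 0 < e / 4 by lra.
have [N hN] := ul _ e4; have [N' hN'] := vm _ e4.
exists (maxn N N') => n; rewrite geq_max => /andP[/hN h1 /hN' h2].
by rewrite opprD addrACA; have := rnorm2D_le (u n - l) (v n - m); lra.
Qed.

Lemma hlim_bop (f : H -> H) u l : is_bop f -> hlim u l ->
  hlim (fun n => f (u n)) (f l).
Proof.
move=> [fl /bounded_rnorm2[c c0 hc]] ul.
by apply: (hlim_dominated c0 _ ul) => n; rewrite -is_linB.
Qed.

Lemma hlimZ (a : R[i]) u l : hlim u l -> hlim (fun n => a *: u n) (a *: l).
Proof.
move=> ul.
apply: (@hlim_dominated _ _ (complex.Re a ^+ 2 + complex.Im a ^+ 2) _ _ _ _ ul).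
  by rewrite addr_ge0 ?sqr_ge0.
by move=> n; rewrite -scalerBr rnorm2Zc.
Qed.

Lemma hlim_shift u l : hlim u l -> hlim (fun n => u n.+1) l.
Proof.
by move=> ul e /ul[N hN]; exists N => n Nn; apply: hN; rewrite (leq_trans Nn).
Qed.

Lemma hlim_rinner u l y (e : R) : 0 < e -> hlim u l ->
  exists N, forall n, (N <= n)%N -> rinner (u n - l) y <= e /\ rinner (l - u n) y <= e.
Proof.
move=> e0 ul; have yp : 0 < rnorm2 y + 1 by have := rnorm2_ge0 y; lra.
(* This is the weight for [rinner_le]: its inverse times |y|^2 is at most e, and eventually its
   product with |u n - l|^2 is below e. The added 1 keeps it positive when y = 0. *)
have t0 : 0 < (rnorm2 y + 1) / e by rewrite divr_gt0.
have [N hN] := ul _ (divr_gt0 e0 t0); exists N => n /hN.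
rewrite ltr_pdivlMr// mulrC => hn.
have hy : ((rnorm2 y + 1) / e)^-1 * rnorm2 y <= e.
  rewrite invf_div mulrAC ler_pdivrMr// ler_pM2l//; lra.
split; have := rinner_le (u n - l) y t0; have := rinner_le (l - u n) y t0.
  lra.
rewrite (rnorm2BC l); lra.
Qed.

(** Passes an adjoint relation to the limit. The auxiliary [re] compares real parts by two
    inequalities up to any e > 0. *)
Lemma hlim_inner u v l m x y : hlim u l -> hlim v m ->
  (forall n, inner H (u n) y = inner H x (v n)) -> inner H l y = inner H x m.
Proof.
have re w k a b : hlim w k -> hlim v m ->
    (forall n, rinner (w n) b = rinner a (v n)) -> rinner k b <= rinner a m /\
    rinner a m <= rinner k b.
  move=> wk vm h; split; apply/ler_addgt0Pr => e e0;
    (have e2 : 0 < e / 2 by lra);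
    have [N hN] := hlim_rinner b e2 wk; have [N' hN'] := hlim_rinner a e2 vm;
    have := hN _ (leq_maxl N N'); have := hN' _ (leq_maxr N N');
    rewrite !rinnerDl !rinnerNl !h !(rinnerC _ a); lra.
move=> ul vm h.
have [a1 a2] : rinner l y <= rinner x m /\ rinner x m <= rinner l y.
  by apply: (re u) => // n; rewrite /rinner h.
(* Multiplying by i turns imaginary parts into real parts, up to sign. *)
have [b1 b2] : rinner ('i%C *: l) y <= rinner ('i%C *: x) m /\
  rinner ('i%C *: x) m <= rinner ('i%C *: l) y.
  apply: (re (fun n => 'i%C *: u n)) => //; first exact: hlimZ.
  by move=> n; rewrite /rinner !innerZl h.
move: a1 a2 b1 b2; rewrite /rinner !innerZl.
case: (inner H l y) => p q; case: (inner H x m) => p' q' /= *.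
by congr (_ +i* _); lra.
Qed.

End Limits.

(** * Square roots and inverses as limits of self-adjoint iterations *)

Section OperatorLimits.
Variables (R : realType) (H : Hilbert R).
Implicit Types (f : nat -> H -> H) (Z E : H -> H).

(** Take N with b N within e of the supremum; this is where the completeness of [R] enters. *)
Lemma bounded_increasing_cauchy (b : nat -> R) (beta : R) :
  (forall n, b n <= b n.+1) -> (forall n, b n <= beta) ->
  forall e : R, 0 < e -> exists N, forall m n, (N <= n)%N -> b m - b n < e.
Proof.
move=> bS bbeta e e0.
have hs : has_sup (range b).
  by split; [exists (b 0%N), 0%N | exists beta => _ [n _ <-]].
have [_ [N _ <-] hN] := sup_adherent e0 hs.
exists N => m n Nn.
have bm : b m <= sup (range b) by apply: (sup_upper_bound hs); exists m.
have bn : b N <= b n by apply: (homo_leq (@lexx _ R) (@le_trans _ R)).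
by rewrite ltrBlDl -ltrBlDr; apply: le_lt_trans (lt_le_trans hN bn); rewrite lerB.
Qed.

(** Method of the scalar majorant: the increments of f are dominated by those of a bounded
    increasing real sequence, so telescoping makes each f n x Cauchy. Self-adjointness and the
    uniform bound pass to the pointwise limit, the latter with a harmless factor 2. *)
Lemma operator_limit f (b : nat -> R) (beta c : R) :
  (forall n, is_adjoint (f n) (f n)) ->
  (forall n, b n <= b n.+1) -> (forall n, b n <= beta) -> 0 <= c ->
  (forall n x, rnorm2 (f n x) <= c * rnorm2 x) ->
  (forall n x, rnorm2 (f n.+1 x - f n x) <= (b n.+1 - b n) ^+ 2 * rnorm2 x) ->
  exists L : H -> H, [/\ is_adjoint L L, is_bounded L &
    forall x, hlim (fun n => f n x) (L x)].
Proof.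
move=> fadj bS bbeta c0 fc fS.
have bmono m n : (m <= n)%N -> b m <= b n.
  by apply: (homo_leq (@lexx _ R) (@le_trans _ R)).
have tele m n x : (n <= m)%N -> rnorm2 (f m x - f n x) <= (b m - b n) ^+ 2 * rnorm2 x.
  move=> /subnK <-; elim: (m - n)%N => [|k IH].
    by rewrite add0n !subrr expr0n mul0r rnorm2_0.
  rewrite addSn -(subrKA (f (k + n)%N x)) -(subrKA (b (k + n)%N) (b _.+1)).
  by apply: rnorm2_Dle => //; rewrite subr_ge0 ?bmono// leq_addl.
have cau x : exists l, hlim (fun n => f n x) l.
  have [|l hl] := @hcomplete _ H (fun n => f n x).
    move=> e e0; have eR : e = (complex.Re e)%:C by rewrite (RRe_real (gtr0_real e0)).
    rewrite eR ltcR in e0; have x1 : 0 < rnorm2 x + 1 by have := rnorm2_ge0 x; lra.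
    (* The cap at 1 gives (b m - b n)^2 <= b m - b n, so the second entry of the minimum can be used
       on the squared increment. *)
    have e1 : 0 < Num.min 1 (complex.Re e / (rnorm2 x + 1)).
      by rewrite lt_min ltr01 divr_gt0.
    have [N hN] := bounded_increasing_cauchy bS bbeta e1.
    exists N; suff w m n : (N <= m)%N -> (N <= n)%N -> (n <= m)%N ->
        rnorm2 (f m x - f n x) < complex.Re e.
      move=> m n Nm Nn; rewrite -[inner _ _ _]/(nsq _) nsqE eR ltcR.
      by case/orP: (leq_total n m) => nm; [exact: w | rewrite rnorm2BC; exact: w].
    move=> Nm Nn nm; apply: le_lt_trans (tele _ _ _ nm) _.
    have := hN m n Nn; rewrite lt_min => /andP[d1].
    rewrite ltr_pdivlMr// => d2; have d0 : 0 <= b m - b n by rewrite subr_ge0 bmono.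
    apply: le_lt_trans d2; rewrite ler_pM ?rnorm2_ge0 ?sqr_ge0//; last lra.
    by rewrite expr2 ler_piMr// ltW.
  exists l => e e0; have [|N hN] := hl e%:C; first by rewrite ltcR.
  by exists N => n /hN; rewrite -[inner _ _ _]/(nsq _) nsqE ltcR.
have [L hL] := choice cau.
exists L; split => //.
  by move=> x y; apply: (hlim_inner (hL x) (hL y)) => n; rewrite fadj.
apply/bounded_rnorm2; exists (2 * c) => [|x]; first by rewrite mulr_ge0.
apply/ler_addgt0Pr => e e0; have e2 : 0 < e / 2 by lra.
have [N hN] := hL x _ e2; have := hN _ (leqnn N).
have := fc N x; have := rnorm2D_le (f N x) (L x - f N x).
by rewrite addrC subrK (rnorm2BC (L x)); lra.
Qed.

(* Positivity of Z (z - Z) Z + (z - Z) Z (z - Z) = z (z Z - Z^2) replaces the Cauchy-Schwarz inequality for the form of Z. *)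
Lemma positive_norm_le Z (z : R) : 0 < z -> is_adjoint Z Z ->
  (forall x, 0 <= rinner (Z x) x <= z * rnorm2 x) ->
  forall x, rnorm2 (Z x) <= z ^+ 2 * rnorm2 x.
Proof.
move=> z0 Zadj Zpos x; have Zlin := adjoint_lin Zadj.
have /andP[_ h1] := Zpos (Z x); have /andP[h2 _] := Zpos (z%:C *: x - Z x).
have /andP[_ h3] := Zpos x.
have e1 : rinner (Z (Z x)) x = rnorm2 (Z x) by rewrite (rinner_adj Zadj).
move: h2; rewrite is_linB// is_linZ// !rinnerDl !rinnerDr !rinnerNl !rinnerNr.
rewrite !rinnerZl !rinnerZr e1 -[rinner (Z x) (Z x)]/(rnorm2 (Z x)) => h2.
have h4 : 0 <= z * (z * rinner (Z x) x - rnorm2 (Z x)) by move: h1 h2; lra.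
rewrite pmulr_rge0// subr_ge0 in h4; apply: le_trans h4 _.
by rewrite expr2 -mulrA ler_pM2l.
Qed.

(** The iteration f (n+1) = (Z + (f n)^2) / 2 from 0 converges to some L with 2 L = Z + L^2, so C =
    1 - L has square 1 - Z. The majorant b is the same iteration with Z replaced by 1; it increases
    and stays below 1. An operator commuting with Z commutes with each iterate, hence with the
    limit. *)
Lemma sqrt_one_sub Z : is_adjoint Z Z -> (forall x, rnorm2 (Z x) <= rnorm2 x) ->
  exists C : H -> H, [/\ is_adjoint C C, is_bounded C,
    forall x, C (C x) = x - Z x &
    forall E, is_bop E -> comm_op E Z -> comm_op E C].
Proof.
move=> Zadj Zc.
pose f := fix f n : H -> H := if n is m.+1
  then fun x => (2^-1 : R)%:C *: (Z x + f m (f m x)) else fun=> 0.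
pose b := fix b n : R := if n is m.+1 then 2^-1 * (1 + b m ^+ 2) else 0.
have fE n x : f n.+1 x = (2^-1 : R)%:C *: (Z x + f n (f n x)) by [].
have bE n : b n.+1 = 2^-1 * (1 + b n ^+ 2) by [].
have f0 x : f 0%N x = 0 by [].
have b_0 : b 0%N = 0 by [].
clearbody f b.
have b01 n : 0 <= b n <= 1.
  elim: n => [|n /andP[b0 b1]]; first by rewrite b_0 lexx ler01.
  rewrite bE; have h : b n ^+ 2 <= 1 by rewrite expr_le1.
  by have h' := sqr_ge0 (b n); apply/andP; split; lra.
have bS n : b n <= b n.+1 by rewrite bE; have := sqr_ge0 (1 - b n); rewrite sqrrB; lra.
have fadj n : is_adjoint (f n) (f n).
  elim: n => [|n IH]; first by move=> x y; rewrite !f0 inner0r inner0l.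
  move=> x y; rewrite !fE; move: x y.
  by apply: adjointZ; apply: adjointD => //; apply: adjoint_comp.
have flin n := adjoint_lin (fadj n).
have fb n x : rnorm2 (f n x) <= b n ^+ 2 * rnorm2 x.
  elim: n x => [|n IH] x; first by rewrite f0 b_0 expr0n mul0r rnorm2_0.
  have /andP[b0 b1] := b01 n.
  rewrite fE bE rnorm2Z exprMn -[leRHS]mulrA ler_wpM2l ?sqr_ge0//.
  apply: rnorm2_Dle; rewrite ?sqr_ge0 ?expr1n ?mul1r//.
  by apply: le_trans (IH _) _; rewrite [(_ ^+ 2) ^+ 2]expr2 -[leRHS]mulrA ler_wpM2l ?sqr_ge0.
have fS n x : rnorm2 (f n.+1 x - f n x) <= (b n.+1 - b n) ^+ 2 * rnorm2 x.
  elim: n x => [|n IH] x; first by rewrite f0 b_0 !subr0.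
  (* A difference of squares a^2 - b^2 is factored as a (a - b) + (a - b) b, which keeps the order
     of the operators. The scalar increments are split in the same way, so the bounds match term by
     term. *)
  have -> : f n.+2 x - f n.+1 x = (2^-1 : R)%:C *:
      (f n.+1 (f n.+1 x - f n x) + (f n.+1 (f n x) - f n (f n x))).
    rewrite [f n.+2 x]fE [X in _ - X = _]fE -scalerBr; congr (_ *: _).
    by rewrite (is_linB (flin n.+1)) addrA subrK opprD addrACA subrr add0r.
  have -> : b n.+2 - b n.+1 = 2^-1 * (b n.+1 * (b n.+1 - b n) + (b n.+1 - b n) * b n).
    by rewrite [b n.+2]bE [X in _ - X = _]bE; ring.
  have /andP[b0 _] := b01 n; have /andP[b1 _] := b01 n.+1.
  have d0 : 0 <= b n.+1 - b n by rewrite subr_ge0.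
  rewrite rnorm2Z exprMn -[leRHS]mulrA ler_wpM2l ?sqr_ge0//.
  apply: rnorm2_Dle; [exact: mulr_ge0 | exact: mulr_ge0 | |].
    by apply: le_trans (fb _ _) _; rewrite exprMn -[leRHS]mulrA ler_wpM2l ?sqr_ge0.
  by apply: le_trans (IH _) _; rewrite exprMn -[leRHS]mulrA ler_wpM2l ?sqr_ge0.
have f1 n x : rnorm2 (f n x) <= 1 * rnorm2 x.
  apply: le_trans (fb _ _) _; rewrite ler_wpM2r ?rnorm2_ge0//.
  by have /andP[b0 b1] := b01 n; rewrite expr_le1.
have [|L [Ladj Lb hL]] := operator_limit fadj bS (beta := 1) _ ler01 f1 fS.
  by move=> n; case/andP: (b01 n).
have Llin := adjoint_lin Ladj.
have LE x : L x = (2^-1 : R)%:C *: (Z x + L (L x)).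
  apply: (hlim_unique (hlim_shift (hL x))).
  rewrite (_ : (fun n => _) = fun n => (2^-1 : R)%:C *: (Z x + f n (f n x))); last first.
    by apply/funext => n; rewrite fE.
  apply: hlimZ; apply: hlimD; first by move=> e e0; exists 0%N => n _;
    rewrite subrr rnorm2_0.
  (* The first summand tends to 0 because the f n are uniformly bounded by 1; the second converges
     to L (L x). *)
  rewrite (_ : (fun n => _) = fun n => f n (f n x - L x) + f n (L x)); last first.
    by apply/funext => n; rewrite -is_linD// subrK.
  rewrite -[L (L x)]add0r; apply: hlimD => //.
  apply: (hlim_dominated (v := fun n => f n x) (m := L x) ler01) => [n|].
    by rewrite subr0.
  exact: hL.
exists (fun x => x - L x); split.
- exact: adjointB.
- by apply: boundedB => //; exact: bounded_id.
- move=> x; rewrite is_linB//; have /(congr1 (fun y => (2 : R)%:C *: y)) := LE x.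
  rewrite scalerA -rmorphM mulfV ?pnatr_eq0// rmorph1 scale1r => e.
  rewrite -[Z x](addrK (L (L x))) -e rmorph_nat scaler_nat mulr2n.
  by rewrite !opprD !opprK !addrA.
- move=> E Eb EZ x; have Elin := Eb.1; rewrite is_linB//; congr (_ - _).
  apply: (hlim_unique (hlim_bop Eb (hL x))).
  suff e n y : E (f n y) = f n (E y) by rewrite (_ : (fun n => _) = fun n => f n (E x)) //;
    apply/funext => n; rewrite e.
  elim: n y => [|n IH] y; first by rewrite !f0 is_lin0.
  by rewrite !fE is_linZ// is_linD// EZ !IH.
Qed.

(** Neumann series: f n is the sum of the powers Z^k for k < n, and b n the corresponding geometric
    sum in z, bounded by 1 / (1 - z). The conclusion gives D as a right inverse; the left inverse
    follows by commutation. *)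
Lemma inv_one_sub Z (z : R) : is_adjoint Z Z -> 0 <= z < 1 ->
  (forall x, rnorm2 (Z x) <= z ^+ 2 * rnorm2 x) ->
  exists D : H -> H, [/\ is_adjoint D D, is_bounded D,
    forall x, D x - Z (D x) = x &
    forall E, is_bop E -> comm_op E Z -> comm_op E D].
Proof.
move=> Zadj /andP[z0 z1] Zc; have Zlin := adjoint_lin Zadj.
have Zb : is_bounded Z by apply/bounded_rnorm2; exists (z ^+ 2); rewrite ?sqr_ge0.
pose f := fix f n : H -> H := if n is m.+1 then fun x => x + Z (f m x) else fun=> 0.
pose b := fix b n : R := if n is m.+1 then 1 + z * b m else 0.
have fE n x : f n.+1 x = x + Z (f n x) by [].
have bE n : b n.+1 = 1 + z * b n by [].
have f0 x : f 0%N x = 0 by [].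
have b_0 : b 0%N = 0 by [].
clearbody f b.
have fcomm E n : is_lin E -> comm_op E Z -> comm_op E (f n).
  move=> Elin EZ; elim: n => [|n IH] y; first by rewrite !f0 is_lin0.
  by rewrite !fE is_linD// EZ !IH.
have fadj n : is_adjoint (f n) (f n).
  elim: n => [|n IH]; first by move=> x y; rewrite !f0 inner0r inner0l.
  move=> x y; rewrite !fE; move: x y.
  (* The adjoint of Z (f n) is (f n) Z, which is the same operator since f n commutes with Z. *)
  apply: adjointD => // x y; rewrite (fcomm Z)//; exact: (adjoint_comp Zadj IH).
have zi : 0 < (1 - z)^-1 by rewrite invr_gt0 subr_gt0.
have b01 n : 0 <= b n <= (1 - z)^-1.
  elim: n => [|n /andP[b0 b1]]; first by rewrite b_0 lexx ltW.
  rewrite bE addr_ge0 ?mulr_ge0//=.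
  have -> : (1 - z)^-1 = 1 + z * (1 - z)^-1 by field; rewrite subr_eq0 gt_eqF.
  by rewrite lerD2l ler_wpM2l.
have bS n : b n <= b n.+1.
  elim: n => [|n IH]; first by rewrite bE b_0 mulr0 addr0.
  by rewrite bE [b n.+2]bE lerD2l ler_wpM2l.
have fb n x : rnorm2 (f n x) <= b n ^+ 2 * rnorm2 x.
  elim: n => [|n IH]; first by rewrite f0 b_0 expr0n mul0r rnorm2_0.
  have /andP[b0 b1] := b01 n.
  rewrite fE bE; apply: rnorm2_Dle => //; [exact: mulr_ge0 | by rewrite expr1n mul1r |].
  by apply: le_trans (Zc _) _; rewrite exprMn -[leRHS]mulrA ler_wpM2l ?sqr_ge0.
have fS n x : rnorm2 (f n.+1 x - f n x) <= (b n.+1 - b n) ^+ 2 * rnorm2 x.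
  elim: n => [|n IH]; first by rewrite f0 b_0 !subr0.
  have -> : f n.+2 x - f n.+1 x = Z (f n.+1 x - f n x).
    by rewrite [f n.+2 x]fE [X in _ - X = _]fE is_linB// opprD addrACA subrr add0r.
  have -> : b n.+2 - b n.+1 = z * (b n.+1 - b n) by rewrite [b n.+2]bE [X in _ - X = _]bE; ring.
  by apply: le_trans (Zc _) _; rewrite exprMn -[leRHS]mulrA ler_wpM2l ?sqr_ge0.
have f1 n x : rnorm2 (f n x) <= (1 - z)^-1 ^+ 2 * rnorm2 x.
  apply: le_trans (fb _ _) _; rewrite ler_wpM2r ?rnorm2_ge0//.
  by have /andP[b0 b1] := b01 n; rewrite ler_sqr ?nnegrE// ltW.
have [|L [Ladj Lb hL]] := operator_limit fadj bS (beta := (1 - z)^-1) _ (sqr_ge0 _) f1 fS.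
  by move=> n; case/andP: (b01 n).
exists L; split => //.
- move=> x; apply/eqP; rewrite subr_eq; apply/eqP.
  apply: (hlim_unique (hlim_shift (hL x))).
  rewrite (_ : (fun n => _) = fun n => x + Z (f n x)); last first.
    by apply/funext => n; rewrite fE.
  apply: hlimD; last exact: hlim_bop.
  by move=> e e0; exists 0%N => n _; rewrite subrr rnorm2_0.
- move=> E Eb EZ x; apply: (hlim_unique (hlim_bop Eb (hL x))).
  rewrite (_ : (fun n => _) = fun n => f n (E x)) //.
  by apply/funext => n; rewrite fcomm//; case: Eb.
Qed.

End OperatorLimits.

(** * Direct sums, operator matrices and ampliations *)

Section DirectSum.
Variable R : rcfType.
Implicit Types H K L : Hilbert R.

Section Space.
Variables H K : Hilbert R.

Definition dsum_inner (p q : H * K) : R[i] := inner H p.1 q.1 + inner K p.2 q.2.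

Fact dsum_inner_linl (a : R[i]) (x y z : H * K) :
  dsum_inner (a *: x + y) z = a * dsum_inner x z + dsum_inner y z.
Proof. by rewrite /dsum_inner /= !inner_linl mulrDr addrACA. Qed.

Fact dsum_inner_conj (x y : H * K) : dsum_inner y x = conjc (dsum_inner x y).
Proof. by rewrite /dsum_inner rmorphD /= -!inner_conj. Qed.

Fact dsum_inner_ge0 (x : H * K) : 0 <= dsum_inner x x.
Proof. by rewrite addr_ge0// inner_ge0. Qed.

Fact dsum_inner_eq0 (x : H * K) : dsum_inner x x = 0 -> x = 0.
Proof.
move=> /eqP; rewrite paddr_eq0 ?inner_ge0// => /andP[/eqP/inner_eq0 e1 /eqP/inner_eq0 e2].
by case: x e1 e2 => ? ? /= -> ->.
Qed.

Fact dsum_complete (u : nat -> H * K) :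
  (forall e : R[i], 0 < e -> exists N : nat, forall m n : nat,
    (N <= m)%N -> (N <= n)%N -> dsum_inner (u m - u n) (u m - u n) < e) ->
  exists l : H * K, forall e : R[i], 0 < e -> exists N : nat,
    forall n : nat, (N <= n)%N -> dsum_inner (u n - l) (u n - l) < e.
Proof.
move=> uc.
have [|l1 h1] := @hcomplete _ H (fst \o u).
  move=> e /uc[N hN]; exists N => m n Nm Nn; apply: le_lt_trans (hN m n Nm Nn).
  by rewrite lerDl inner_ge0.
have [|l2 h2] := @hcomplete _ K (snd \o u).
  move=> e /uc[N hN]; exists N => m n Nm Nn; apply: le_lt_trans (hN m n Nm Nn).
  by rewrite lerDr inner_ge0.
exists (l1, l2) => e e0; have e2 : 0 < e / 2 by rewrite divr_gt0.
have [N1 hN1] := h1 _ e2; have [N2 hN2] := h2 _ e2.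
exists (maxn N1 N2) => n; rewrite geq_max => /andP[/hN1 d1 /hN2 d2].
by rewrite [e]splitr; apply: ltrD.
Qed.

Definition dsum : Hilbert R := Build_Hilbert dsum_inner_linl dsum_inner_conj
  dsum_inner_ge0 dsum_inner_eq0 dsum_complete.

End Space.

Lemma adjoint_pair H K L (f : L -> H) (g : L -> K) f' g' :
  is_adjoint f f' -> is_adjoint g g' ->
  is_adjoint (K := dsum H K) (fun x => (f x, g x)) (fun y => f' y.1 + g' y.2).
Proof. by move=> ff gg x y; rewrite innerDr -ff -gg. Qed.

Lemma rnorm2_pair H K (x : dsum H K) : rnorm2 x = rnorm2 x.1 + rnorm2 x.2.
Proof. by rewrite /rnorm2 /rinner /= /dsum_inner raddfD. Qed.

Lemma bounded_pair H K L (f : L -> H) (g : L -> K) :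
  is_bounded f -> is_bounded g -> is_bounded (K := dsum H K) (fun x => (f x, g x)).
Proof.
move=> /bounded_rnorm2[c c0 hf] /bounded_rnorm2[d d0 hg]; apply/bounded_rnorm2.
exists (c + d) => [|x]; first exact: addr_ge0.
by rewrite rnorm2_pair mulrDl lerD /=.
Qed.

Lemma bounded_fst H K : is_bounded (H := dsum H K) (K := H) fst.
Proof.
apply/bounded_rnorm2; exists 1 => // x; rewrite rnorm2_pair.
by have := rnorm2_ge0 x.2; lra.
Qed.

Lemma bounded_snd H K : is_bounded (H := dsum H K) (K := K) snd.
Proof.
apply/bounded_rnorm2; exists 1 => // x; rewrite rnorm2_pair.
by have := rnorm2_ge0 x.1; lra.
Qed.

(** The operator matrix with rows (a, b) and (c, d), acting on columns. *)
Definition block H (a b c d : H -> H) (y : dsum H H) : dsum H H :=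
  (a y.1 + b y.2, c y.1 + d y.2).

Lemma adjoint_block H (a b c d a' b' c' d' : H -> H) :
  is_adjoint a a' -> is_adjoint b b' -> is_adjoint c c' -> is_adjoint d d' ->
  is_adjoint (block a b c d) (block a' c' b' d').
Proof.
move=> aa bb cc dd x y /=; rewrite /dsum_inner /= !innerDl !innerDr aa bb cc dd.
by rewrite addrACA.
Qed.

Lemma bounded_block H (a b c d : H -> H) :
  is_bounded a -> is_bounded b -> is_bounded c -> is_bounded d ->
  is_bounded (block a b c d).
Proof.
move=> ? ? ? ?; have b1 := @bounded_fst H H; have b2 := @bounded_snd H H.
by apply: bounded_pair; apply: boundedD; apply: bounded_comp.
Qed.

(** The ampliation of f: the same operator in both summands, not a general diagonal matrix. *)
Definition diag H (f : H -> H) (y : dsum H H) : dsum H H := (f y.1, f y.2).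

Lemma adjoint_diag H (f f' : H -> H) : is_adjoint f f' ->
  is_adjoint (diag f) (diag f').
Proof. by move=> ff x y; rewrite /= /dsum_inner !ff. Qed.

Lemma lin_diag H (f : H -> H) : is_lin f -> is_lin (diag f).
Proof. by move=> fl a x y; rewrite /diag /= !fl. Qed.

Lemma bop_diag H (f : H -> H) : is_bop f -> is_bop (diag f).
Proof.
move=> [fl fb]; split; first exact: lin_diag.
apply: bounded_pair; apply: bounded_comp => //; [exact: bounded_fst | exact: bounded_snd].
Qed.

Lemma inverse_diag H (f fi : H -> H) : is_inverse f fi -> is_inverse (diag f) (diag fi).
Proof.
move=> [fib [fK fiK]]; split; first exact: bop_diag.
by split => -[y1 y2]; rewrite /diag /= ?fK ?fiK.
Qed.

Lemma comm_op_diag H (e f : H -> H) : comm_op e f -> comm_op (diag e) (diag f).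
Proof. by move=> ef x; rewrite /diag /= !ef. Qed.

Lemma comm_op_block H (e a b c d : H -> H) : is_lin e ->
  comm_op e a -> comm_op e b -> comm_op e c -> comm_op e d ->
  comm_op (diag e) (block a b c d).
Proof. by move=> el ea eb ec ed x; rewrite /diag /block /= !is_linD// ea eb ec ed. Qed.

Lemma orth_proj_diag H (P : H -> H) : is_orth_proj P -> is_orth_proj (diag P).
Proof.
move=> [Pb [PP Padj]]; split; first exact: bop_diag.
by split; [move=> x; rewrite /diag /= !PP | exact: adjoint_diag].
Qed.

(** Keeps the operators that are already dilated in their class when the space is doubled;
    [C1r_diag] does the same for those still to be dilated. *)
Lemma calC1r_diag (r : R) H (M Ma : H -> H) : in_calC1r r M Ma ->
  in_calC1r r (diag M) (diag Ma).
Proof.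
move=> [Mb [P0 [P1 [h0 [h1 [hs hM]]]]]]; split; first exact: bop_diag.
exists (diag P0), (diag P1); split; first exact: orth_proj_diag.
split; first exact: orth_proj_diag.
by split=> -[x1 x2]; rewrite /diag /= ?hM; congr pair; rewrite /= ?hs.
Qed.

Lemma C1r_diag (r : R) H (T Ti : H -> H) : in_C1r r T Ti ->
  in_C1r r (diag T) (diag Ti).
Proof.
move=> [Tb [Tinv [h1 h2]]]; split; first exact: bop_diag.
split; first exact: inverse_diag.
by split => x; rewrite /nsq /= /dsum_inner lerD//; [exact: h1|exact: h1|exact: h2|exact: h2].
Qed.

End DirectSum.

(* Vector identities are checked on the inner products with all z, where ring applies. *)
Ltac lmod := apply: inner_inj => ?;
  rewrite ?scaler0 !(innerDl, innerNl, innerZl, inner0l).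

(** * Dilation of a single operator *)

Section OneVariable.
Variables (R : realType) (r : R) (H : Hilbert R) (T Ti Ta : H -> H).
Hypotheses (r_gt0 : 0 < r) (r_lt1 : r < 1).
Hypotheses (TC1r : in_C1r r T Ti) (TTa : is_adjoint T Ta).

Let B x := Ta (T x).

Let r2_gt0 : 0 < r ^+ 2. Proof. by rewrite exprn_gt0. Qed.
Let r2_lt1 : r ^+ 2 < 1. Proof. by rewrite expr_lt1// ltW. Qed.

Let T_lin : is_lin T. Proof. exact: adjoint_lin TTa. Qed.
Let Ta_lin : is_lin Ta. Proof. exact: adjoint_lin (adjoint_sym TTa). Qed.
Let TK : cancel T Ti. Proof. by case: TC1r => _ [[_ []]]. Qed.
Let TiK : cancel Ti T. Proof. by case: TC1r => _ [[_ []]]. Qed.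

Let T_contr x : rnorm2 (T x) <= rnorm2 x.
Proof. by case: TC1r => _ [_ [+ _]] => /(_ x); rewrite !nsqE lecR. Qed.

Let T_expand x : r ^+ 2 * rnorm2 x <= rnorm2 (T x).
Proof. by case: TC1r => _ [_ [_ /(_ (T x))]]; rewrite TK !nsqE lecR rnorm2Z. Qed.

Let T_bounded : is_bounded T. Proof. by case: TC1r => -[]. Qed.
Let Ta_bounded : is_bounded Ta. Proof. exact: contraction_adjoint_bounded TTa T_contr. Qed.

Let B_adj : is_adjoint B B. Proof. exact: adjoint_comp TTa (adjoint_sym TTa). Qed.
Let B_bop : is_bop B.
Proof. by split; [exact: adjoint_lin B_adj | exact: bounded_comp]. Qed.
Let B_lin : is_lin B. Proof. by case: B_bop. Qed.
Let rinner_B x : rinner (B x) x = rnorm2 (T x).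
Proof. by rewrite (rinner_adj (adjoint_sym TTa)). Qed.

(** Since r^2 <= B <= 1, the operator Z = 1 - B lies between 0 and 1 - r^2 < 1, and the Neumann
    series for 1 - Z inverts B. *)
Let B_inv : exists D : H -> H, [/\ is_adjoint D D, is_bounded D,
  forall x, B (D x) = x & forall E, is_bop E -> comm_op E B -> comm_op E D].
Proof.
have Zadj : is_adjoint (fun x => x - B x) (fun x => x - B x).
  by apply: adjointB => //; exact: adjoint_id.
have [||D [Dadj Db DE Dcomm]] := inv_one_sub (z := 1 - r ^+ 2) Zadj.
- by move: r2_gt0 r2_lt1 => *; apply/andP; split; lra.
- apply: positive_norm_le => // [|x]; first by rewrite subr_gt0.
  rewrite rinnerDl rinnerNl rinner_B -[rinner x x]/(rnorm2 x).
  by have := T_expand x; have := T_contr x => *; apply/andP; split; lra.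
exists D; split=> [//|//|x|E Eb EB].
  by have := DE x; rewrite opprB addrC subrK.
by apply: Dcomm => // x; rewrite is_linB ?EB; case: Eb.
Qed.

Let w := (1 - r ^+ 2)^-1.
Let w_gt0 : 0 < w. Proof. by rewrite invr_gt0 subr_gt0. Qed.
Let wE : w * (1 - r ^+ 2) = 1. Proof. by rewrite mulVf// gt_eqF// subr_gt0. Qed.

(* The angle operators: C^2 = (B - r^2)/(1 - r^2) and S^2 = (1 - B)/(1 - r^2). *)
Let angle_ops : exists C S : H -> H,
  [/\ is_adjoint C C, is_bounded C, is_adjoint S S & is_bounded S] /\
  [/\ forall x, C (C x) + S (S x) = x,
      forall x, C (C x) + (r ^+ 2)%:C *: S (S x) = B x,
      forall x, S (C x) = C (S x) &
      forall E, is_bop E -> comm_op E B -> comm_op E C /\ comm_op E S].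
Proof.
(* [Z1] and [Z2] add up to 1, so [sqrt_one_sub] applied to [Z1] gives the root C of [Z2], and
   applied to [Z2] gives the root S of [Z1]. *)
pose Z1 x := w%:C *: (x - B x); pose Z2 x := w%:C *: (B x - (r ^+ 2)%:C *: x).
have wn n : n = w * ((1 - r ^+ 2) * n) by rewrite mulrA wE mul1r.
have adj1 : is_adjoint Z1 Z1.
  by apply: adjointZ; apply: adjointB => //; exact: adjoint_id.
have adj2 : is_adjoint Z2 Z2.
  by apply: adjointZ; apply: adjointB => //; apply: adjointZ; exact: adjoint_id.
have bnd1 x : rnorm2 (Z1 x) <= rnorm2 x.
  rewrite -[leRHS]mul1r -(expr1n _ 2); apply: positive_norm_le => // y.
  rewrite rinnerZl rinnerDl rinnerNl rinner_B mul1r -[rinner y y]/(rnorm2 y).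
  rewrite mulr_ge0 ?subr_ge0 ?(ltW w_gt0)//= [leRHS]wn ler_pM2l//.
  by have := T_expand y; lra.
have bnd2 x : rnorm2 (Z2 x) <= rnorm2 x.
  rewrite -[leRHS]mul1r -(expr1n _ 2); apply: positive_norm_le => // y.
  rewrite rinnerZl rinnerDl rinnerNl rinner_B mul1r rinnerZl -[rinner y y]/(rnorm2 y).
  rewrite mulr_ge0 ?subr_ge0 ?(ltW w_gt0)//= [leRHS]wn ler_pM2l//.
  by have := T_contr y; lra.
have [C [Cadj Cb CC Ccomm]] := sqrt_one_sub adj1 bnd1.
have [S [Sadj Sb SS Scomm]] := sqrt_one_sub adj2 bnd2.
have comm E : is_bop E -> comm_op E B -> comm_op E C /\ comm_op E S.
  move=> Eb EB; have El := Eb.1; split; [apply: Ccomm | apply: Scomm] => // x.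
    by rewrite /Z1 is_linZ// is_linB// EB.
  by rewrite /Z2 is_linZ// is_linB// EB is_linZ.
have weq : w%:C * (r ^+ 2)%:C = w%:C - 1.
  by rewrite -(rmorph1 (real_complex R)) -rmorphB -rmorphM -wE; congr _%:C; ring.
exists C, S; split => //; split => //.
- move=> x; rewrite CC SS; apply: inner_inj => z.
  rewrite /Z1 /Z2 !(innerDl, innerNl, innerZl).
  by ring: weq.
- move=> x; rewrite CC SS; apply: inner_inj => z.
  rewrite /Z1 /Z2 !(innerDl, innerNl, innerZl, scalerBr).
  by ring: weq.
(* The commutation property is used twice: for E = B it shows that B commutes with C, then for E = C
   that C commutes with S. *)
- have CB : comm_op C B by apply: comm_op_sym; case: (comm B B_bop).
  have Cbop : is_bop C by split => //; exact: adjoint_lin Cadj.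
  by have [_ CS] := comm C Cbop CB => x; rewrite CS.
Qed.

(** M is the product [Om] (G + G) N, with direct sums of operators written +. On the range of V, N
    produces (B x, 0), G + G turns it into (T x, 0), and [Om] sends that to V (T x). The last
    clause, on operators E, is what lets the other members of a tuple be carried along. *)
Lemma one_variable_dilation :
  exists (V : H -> dsum H H) (Va : dsum H H -> H) (M Mi Ma : dsum H H -> dsum H H),
  [/\ is_isometry V, is_adjoint V Va & forall x, M (V x) = V (T x)] /\
  [/\ is_adjoint M Ma, is_inverse M Mi & in_calC1r r M Ma] /\
  forall E, is_bop E -> comm_op E T -> comm_op E Ta ->
  [/\ forall x, V (E x) = diag E (V x), comm_op (diag E) M & comm_op (diag E) Ma].
Proof.
have [D [Dadj Db BD Dcomm]] := B_inv.
have [C [S [[Cadj Cb Sadj Sb] [CCSS CCrSS SC CScomm]]]] := angle_ops.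
have DB x : D (B x) = x by rewrite -[RHS]BD (Dcomm B).
have Clin := adjoint_lin Cadj; have Slin := adjoint_lin Sadj.
have Dlin := adjoint_lin Dadj.
have DC : comm_op D C.
  by apply: comm_op_sym; apply: Dcomm => //; apply: comm_op_sym; case: (CScomm B).
have DS : comm_op D S.
  by apply: comm_op_sym; apply: Dcomm => //; apply: comm_op_sym; case: (CScomm B).
pose q := (r ^+ 2)%:C.
have r_neq0 : r%:C != 0 :> R[i] by rewrite fmorph_eq0 gt_eqF.
have CC x : C (C x) = x - S (S x) by have /(canRL (addrK _)) := CCSS x.
have CCB x : B x = x - S (S x) + q *: S (S x) by rewrite -CC CCrSS.
pose V x : dsum H H := (C x, S x).
pose Va (y : dsum H H) := C y.1 + S y.2.
(* The rotation by the angle operators: it is unitary and its first column is V. *)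
pose Om := block C (fun x => - S x) S C.
pose Oma := block C S (fun x => - S x) C.
(* N = N' diag(1, r), where N' has rows (C, r S) and (- r S, C). The adjoint of N' times N' is B +
   B, so inserting B^-1 between [Na] and N leaves diag(1, r^2); this avoids the square root of B. *)
pose N := block C (fun x => q *: S x) (fun x => - (r%:C *: S x)) (fun x => r%:C *: C x).
pose Na := block C (fun x => - (r%:C *: S x)) (fun x => q *: S x) (fun x => r%:C *: C x).
(* The inverse of N' is (D + D) times its adjoint; multiplying on the left by diag(1, 1/r) gives
   [Ni]. *)
pose Ni := block (fun x => D (C x)) (fun x => - (r%:C *: D (S x)))
  (fun x => D (S x)) (fun x => r^-1%:C *: D (C x)).
(* G = T B^-1 is the inverse of [Ta], and [Ga] G = B^-1. *)
pose G x := T (D x); pose Ga x := D (Ta x).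
have G_adj : is_adjoint G Ga by exact: adjoint_comp Dadj TTa.
have Om_adj : is_adjoint Om Oma by apply: adjoint_block => //; exact: adjointN.
have N_adj : is_adjoint N Na.
  by apply: adjoint_block; rewrite //; [exact: adjointZ | apply: adjointN; exact: adjointZ | exact: adjointZ].
have OmaOm y : Oma (Om y) = y.
  case: y => y1 y2; rewrite /Oma /Om /block /=.
  rewrite !(is_linD Clin) !(is_linD Slin) !(is_linN Clin) !(is_linN Slin) !SC !CC.
  by congr pair; lmod; ring.
have OmOma y : Om (Oma y) = y.
  case: y => y1 y2; rewrite /Oma /Om /block /=.
  rewrite !(is_linD Clin) !(is_linD Slin) !(is_linN Clin) !(is_linN Slin) !SC !CC.
  by congr pair; lmod; ring.
have qE : q = r%:C ^+ 2 by rewrite /q rmorphXn.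
have rV : r%:C * (r^-1)%:C = 1 :> R[i] by rewrite -rmorphM mulfV ?rmorph1// gt_eqF.
(* Each entry of y on the right is written as D (B y). Expressing B and C^2 through S^2 then reduces
   both sides to D applied to vectors in S^2 and C S, and the mixed terms cancel. The same device
   proves [NNi] and [NaDN]. *)
have NiN y : Ni (N y) = y.
  case: y => y1 y2; rewrite /Ni /N /block /= -[y1 in RHS]DB -[y2 in RHS]DB !CCB.
  rewrite !(is_linD Clin, is_linD Slin, is_linD Dlin, is_linN Clin, is_linN Slin,
    is_linN Dlin, is_linZ Clin, is_linZ Slin, is_linZ Dlin) !SC !CC
    !(is_linD Dlin, is_linN Dlin).
  by congr pair; lmod; rewrite ?qE; ring: rV.
have NNi y : N (Ni y) = y.
  case: y => y1 y2; rewrite /Ni /N /block /= -[y1 in RHS]DB -[y2 in RHS]DB !CCB.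
  rewrite !(is_linD Clin, is_linD Slin, is_linD Dlin, is_linN Clin, is_linN Slin,
    is_linN Dlin, is_linZ Clin, is_linZ Slin, is_linZ Dlin) -!DC -!DS !SC !CC
    !(is_linD Dlin, is_linN Dlin).
  by congr pair; lmod; rewrite ?qE; ring: rV.
have NV x : N (V x) = (B x, 0).
  rewrite /N /V /block /= CCB !SC !CC.
  by congr pair; lmod; rewrite ?qE; ring: rV.
have NaDN y : Na (diag D (N y)) = (y.1, q *: y.2).
  case: y => y1 y2; rewrite /Na /N /diag /block /= -[y1 in RHS]DB -[y2 in RHS]DB !CCB.
  rewrite !(is_linD Clin, is_linD Slin, is_linD Dlin, is_linN Clin, is_linN Slin,
    is_linN Dlin, is_linZ Clin, is_linZ Slin, is_linZ Dlin) -!DC -!DS !SC !CC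
    !(is_linD Dlin, is_linN Dlin).
  by congr pair; lmod; rewrite ?qE; ring: rV.
have GaG x : Ga (G x) = D x by rewrite /Ga /G -/(B _) BD.
have TaG x : Ta (G x) = x by exact: BD.
have GTa x : G (Ta x) = x by rewrite -[x]TiK -/(B _) /G DB.
exists V, Va, (fun y => Om (diag G (N y))), (fun y => Ni (diag Ta (Oma y))),
  (fun y => Na (diag Ga (Oma y))).
have V_adj : is_adjoint V Va by exact: adjoint_pair.
have M_adj : is_adjoint (fun y => Om (diag G (N y))) (fun y => Na (diag Ga (Oma y))).
  exact: adjoint_comp (adjoint_comp N_adj (adjoint_diag G_adj)) Om_adj.
have Om_b : is_bounded Om by apply: bounded_block => //; exact: boundedN.
have Oma_b : is_bounded Oma by apply: bounded_block => //; exact: boundedN.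
have N_b : is_bounded N.
  by apply: bounded_block; rewrite //; [exact: boundedZ | apply: boundedN; exact: boundedZ | exact: boundedZ].
have Ni_b : is_bounded Ni.
  apply: bounded_block; [|apply: boundedN; apply: boundedZ| |apply: boundedZ];
  exact: bounded_comp.
have diag_b f : is_lin f -> is_bounded f -> is_bounded (diag f).
  by move=> fl fb; case: (bop_diag (conj fl fb)).
have M_b : is_bounded (fun y => Om (diag G (N y))).
  apply: bounded_comp => //; apply: bounded_comp => //; apply: diag_b.
    exact: adjoint_lin G_adj.
  exact: bounded_comp.
have M_lin := adjoint_lin M_adj.
have Mi_b : is_bounded (fun y => Ni (diag Ta (Oma y))).
  by apply: bounded_comp => //; apply: bounded_comp => //; exact: diag_b.
have MMi y : Om (diag G (N (Ni (diag Ta (Oma y))))) = y.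
  by rewrite NNi [diag G _](_ : _ = Oma y) ?OmOma//; case: (Oma y) => *; congr pair; exact: GTa.
have MiM y : Ni (diag Ta (Oma (Om (diag G (N y))))) = y.
  by rewrite OmaOm [diag Ta _](_ : _ = N y) ?NiN//; case: (N y) => *; congr pair; exact: TaG.
split; [split|split; [split|]].
- split; first exact: adjoint_lin V_adj.
  by move=> x y; rewrite V_adj /Va CCSS.
- exact: V_adj.
- move=> x; rewrite NV /diag /= /G DB /Om /block /V /= (is_lin0 Dlin) (is_lin0 T_lin).
  by rewrite (is_lin0 Clin) (is_lin0 Slin) subr0 addr0.
- exact: M_adj.
- split=> //; split=> // a x y.
  (* M is linear and injective, so its inverse is linear. *)
  by apply: (can_inj MiM); rewrite M_lin !MMi.
- split; first by split.
  exists (fun y => (y.1, 0)), (fun y => (0, y.2)).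
  have P0 : is_adjoint (H := dsum H H) (K := dsum H H) (fun y => (y.1, 0)) (fun y => (y.1, 0)).
    by move=> x y; rewrite /= /dsum_inner /= inner0l inner0r.
  have P1 : is_adjoint (H := dsum H H) (K := dsum H H) (fun y => (0, y.2)) (fun y => (0, y.2)).
    by move=> x y; rewrite /= /dsum_inner /= inner0l inner0r.
  split; [|split; [|split]].
  + split; last by split.
    split; first exact: adjoint_lin P0.
    apply/bounded_rnorm2; exists 1 => // y; rewrite !rnorm2_pair /= rnorm2_0.
    by have := rnorm2_ge0 y.2; lra.
  + split; last by split.
    split; first exact: adjoint_lin P1.
    apply/bounded_rnorm2; exists 1 => // y; rewrite !rnorm2_pair /= rnorm2_0.
    by have := rnorm2_ge0 y.1; lra.
  + by case=> y1 y2; congr pair; rewrite /= ?addr0 ?add0r.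
  + move=> y; rewrite OmaOm /diag /= !GaG NaDN -/q.
    by congr pair; rewrite /= ?scaler0 ?addr0 ?add0r.
- move=> E Eb ET ETa; have El := Eb.1.
  have EB : comm_op E B by exact: comm_op_comp.
  have [EC ES] := CScomm E Eb EB; have ED := Dcomm E Eb EB.
  have commN f : comm_op E f -> comm_op E (fun x => - f x).
    by move=> Ef x; rewrite is_linN ?Ef.
  have commZ a f : comm_op E f -> comm_op E (fun x => a *: f x).
    by move=> Ef x; rewrite is_linZ ?Ef.
  have EN : comm_op (diag E) N.
    by apply: comm_op_block; auto.
  have ENa : comm_op (diag E) Na by apply: comm_op_block; auto.
  have EOm : comm_op (diag E) Om by apply: comm_op_block; auto.
  have EOma : comm_op (diag E) Oma by apply: comm_op_block; auto.
  split.
  + by move=> x; rewrite /V /diag /= EC ES.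
  + by move=> y; rewrite EOm (comm_op_diag (comm_op_comp ET ED)) EN.
  + by move=> y; rewrite ENa (comm_op_diag (comm_op_comp ED ETa)) EOma.
Qed.

End OneVariable.

(** * Integer powers and induction over the tuple *)

Lemma multipow_intertwine (R : rcfType) (d : nat) (H K : Hilbert R) (V : H -> K)
  (T Ti : 'I_d -> H -> H) (M Mi : 'I_d -> K -> K) (n : 'I_d -> int) :
  (forall j x, M j (V x) = V (T j x)) -> (forall j x, Mi j (V x) = V (Ti j x)) ->
  forall x, multipow M Mi n (V x) = V (multipow T Ti n x).
Proof.
move=> MV MiV x; rewrite /multipow; elim: (enum _) => //= j s ->.
have iterV f g : (forall y, f (V y) = V (g y)) ->
    forall k y, iter k f (V y) = V (iter k g y).
  by move=> fg; elim=> //= k IH y; rewrite IH fg.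
case: (n j) => k /=; first exact: iterV.
by rewrite (iterV _ (Ti j)).
Qed.

(** Induction on the number k of operators already dilated. The remaining ones stay in the class
    [in_C1r] and the tuple stays doubly commuting, so the next operator can be dilated over the
    current space. *)
Lemma partial_dilation (R : realType) (r : R) (d : nat) (H : Hilbert R)
  (T Ti Ta : 'I_d -> H -> H) :
  0 < r -> r < 1 -> (forall j, in_C1r r (T j) (Ti j)) ->
  (forall j, is_adjoint (T j) (Ta j)) -> doubly_commuting T Ta ->
  forall k : nat, (k <= d)%N ->
  exists (K : Hilbert R) (V : H -> K) (Va : K -> H) (M Mi Ma : 'I_d -> K -> K),
    [/\ is_isometry V, is_adjoint V Va & forall j x, M j (V x) = V (T j x)] /\
    [/\ forall j, is_adjoint (M j) (Ma j), forall j, is_inverse (M j) (Mi j) &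
        forall j, is_bop (M j)] /\
    [/\ forall j : 'I_d, (j < k)%N -> in_calC1r r (M j) (Ma j),
        forall j : 'I_d, (k <= j)%N -> in_C1r r (M j) (Mi j) & doubly_commuting M Ma].
Proof.
move=> r0 r1 TC TTa Tdc; elim=> [_|k IH kd].
  exists H, id, id, T, Ti, Ta; split; first by [].
  by split; split=> // j; case: (TC j) => ? [].
have [K [V [Va [M [Mi [Ma [[Viso VVa MV] [[MMa Minv Mb] [McalC MC [Mc Mdc]]]]]]]]]] :=
  IH (ltnW kd).
pose k0 := Ordinal kd.
have [W [Wa [N [Ni [Na [[Wiso WWa NW] [[NNa Ninv NcalC] Ncomm]]]]]]] :=
  one_variable_dilation r0 r1 (MC k0 (leqnn _)) (MMa k0).
(* The new tuple has the dilation at index [k0] and ampliations elsewhere. *)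
pose pick (f : 'I_d -> K -> K) g j := if j == k0 then g else diag (f j).
have MMa_sym j := adjoint_sym (MMa j).
(* Double commutation says that M j commutes with M [k0] and with its adjoint, so E = M j is
   admissible in the one-variable dilation. *)
have comm j : j != k0 -> [/\ forall x, W (M j x) = diag (M j) (W x),
    comm_op (diag (M j)) N & comm_op (diag (M j)) Na].
  move=> jk; by apply: Ncomm => // x; apply: Mdc.
exists (dsum K K), (fun x => W (V x)), (fun y => Va (Wa y)).
exists (pick M N), (pick Mi Ni), (pick Ma Na).
split; [split|split; split].
- split; last by move=> x y; rewrite Wiso.2 Viso.2.
  by move=> a x y; rewrite Viso.1 Wiso.1.
- exact: adjoint_comp VVa WWa.
- move=> j x; rewrite /pick; case: eqVneq => [->|jk]; first by rewrite NW MV.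
  by have [<- _ _] := comm j jk; rewrite MV.
- by move=> j; rewrite /pick; case: eqVneq => // _; exact: adjoint_diag.
- by move=> j; rewrite /pick; case: eqVneq => // _; exact: inverse_diag.
- by move=> j; rewrite /pick; case: eqVneq => [_|_]; [case: NcalC | exact: bop_diag].
- move=> j; rewrite ltnS leq_eqVlt => /orP[/eqP jk|jk].
    by rewrite /pick (_ : j = k0) ?eqxx //; apply: val_inj.
  by rewrite /pick; case: eqVneq => // _; apply: calC1r_diag; exact: McalC.
- move=> j kj; rewrite /pick; case: eqVneq => [jk|_].
    by rewrite jk /= ltnn in kj.
  by apply: C1r_diag; apply: MC; exact: ltnW.
split=> i j x; rewrite /pick.
  case: (eqVneq i k0) => [_|ik]; case: (eqVneq j k0) => [_|jk] //.
  - by have [_ -> _] := comm j jk.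
  - by have [_ -> _] := comm i ik.
  - by apply: comm_op_diag => y; exact: Mc.
case: (eqVneq i k0) => [ik|ik]; case: (eqVneq j k0) => [jk|jk] // ij.
- by rewrite ik jk eqxx in ij.
(* Here N must commute with the ampliation of [Ma] j: take adjoints in the relation between the
   ampliation of M j and [Na]. *)
- have [_ _ h] := comm j jk.
  by apply: comm_op_sym x; exact: (comm_op_adj (adjoint_diag (MMa j)) (adjoint_sym NNa) h).
- by have [_ _ ->] := comm i ik.
- by apply: comm_op_diag => y; exact: Mdc.
Qed.


Theorem theorem2p5 (R : realType) (r : R) (d : nat) (H : Hilbert R)
  (T Ti Ta : 'I_d -> H -> H) :
  0 < r -> r < 1 ->
  (forall j, in_C1r r (T j) (Ti j)) ->
  (forall j, is_adjoint (T j) (Ta j)) ->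
  doubly_commuting T Ta ->
  (* sigma((T_j^* T_j)^{1/2}) is a finite subset of (r,1) *)
  (forall j (A : H -> H), is_positive A -> (forall x, A (A x) = Ta j (T j x)) ->
     (exists s : seq R[i], forall l, spectrum A l -> l \in s) /\
     (forall l, spectrum A l -> r%:C < l /\ l < 1)) ->
  exists (K : Hilbert R) (V : H -> K) (Va : K -> H) (M Mi Ma : 'I_d -> K -> K),
    is_isometry V /\ is_adjoint V Va /\
    (forall j, is_adjoint (M j) (Ma j)) /\
    (forall j, is_inverse (M j) (Mi j)) /\
    (forall j, in_calC1r r (M j) (Ma j)) /\
    doubly_commuting M Ma /\
    forall (n : 'I_d -> int) (x : H),
      multipow T Ti n x = Va (multipow M Mi n (V x)).
Proof.
move=> r0 r1 TC TTa Tdc _.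
have [K [V [Va [M [Mi [Ma [[Viso VVa MV] [[MMa Minv Mb] [McalC _ Mdc]]]]]]]]] :=
  partial_dilation r0 r1 TC TTa Tdc (leqnn d).
exists K, V, Va, M, Mi, Ma; split=> //; split=> //; split=> //; split=> //.
split; first by move=> j; exact: McalC.
split=> // n x.
have VaV y : Va (V y) = y.
  by apply: inner_inj => z; rewrite (adjoint_sym VVa) Viso.2.
(* Negative powers need the intertwining of the inverses: apply [MV] to [Ti] j y and cancel M j. *)
have MiV j y : Mi j (V y) = V (Ti j y).
  have [_ [MK _]] := Minv j; have [_ [[_ [_ TiK]] _]] := TC j.
  by rewrite -[y in LHS]TiK -MV MK.
by rewrite (multipow_intertwine _ MV MiV) VaV.
Qed.
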